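(* Let $N\ge2$, $\gamma>0$ and $\omega\in\mathbb{R}$. For each integer $\kappa$ with $0\le\kappa\le[(N-1)/2]$ let $h_\kappa=\gamma/(N-2\kappa)$ and define $\phi^\kappa_{\omega,\gamma}$ on $\Gamma$ by $$(\phi^\kappa_{\omega,\gamma})_i(x)=e^{\frac{\omega+1}{2}}e^{-\frac12(x-h_\kappa)^2}\ (i=1,\dots,\kappa),\qquad (\phi^\kappa_{\omega,\gamma})_i(x)=e^{\frac{\omega+1}{2}}e^{-\frac12(x+h_\kappa)^2}\ (i=\kappa+1,\dots,N).$$ Then the positive solutions $\varphi\in W(\Gamma)$ of the stationary problem $$-\Delta_\gamma\varphi+\omega\varphi-\varphi\log|\varphi|^2=0\quad\text{in } W'(\Gamma)$$ are exactly, up to permutations of the edges, these $[(N-1)/2]+1$ functions $\phi^\kappa_{\omega,\gamma}$, $\kappa=0,\dots,[(N-1)/2]$.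
   Context: $[s]$ denotes the integer part of $s$. The star graph $\Gamma$ consists of $N$ half-lines $(0,\infty)$ joined at the vertex $x=0$; functions on $\Gamma$ are tuples $u=(u_e)_{e=1}^N$, $u_e:(0,\infty)\to\mathbb{C}$, $u_e(0)=\lim_{x\to0^+}u_e(x)$. $H^1(\Gamma)$: $u_e\in H^1(\mathbb{R}^+)$ for all $e$ and $u_1(0)=\dots=u_N(0)$. $W(\Gamma)=\{u\in H^1(\Gamma):|u_e|^2\log|u_e|^2\in L^1(\mathbb{R}^+)\ \forall e\}$, a Banach space (with the norm $\|u\|^2_{W}=\sum_e(\|u_e\|_{H^1}+\|u_e\|_{L^A})^2$, $L^A$ the Orlicz space of the Young function $A(s)=-s^2\log s^2$ for $s\le e^{-3}$, $A(s)=3s^2+4e^{-3}s-e^{-6}$ for $s\ge e^{-3}$, with Luxemburg norm); $W'(\Gamma)$ its dual. $-\Delta_\gamma:W(\Gamma)\to W'(\Gamma)$ is given by $\langle-\Delta_\gamma u,v\rangle=\mathrm{Re}\sum_e\int_0^\infty\partial_xu_e\overline{\partial_xv_e}\,dx-\gamma\,\mathrm{Re}(u_1(0)\overline{v_1(0)})$; it is the operator acting as $-\partial_x^2$ on each edge with vertex condition $\sum_e\partial_xu_e(0)=-\gamma u_1(0)$. The nonlinearity is componentwise: $(\varphi\log|\varphi|^2)_e=\varphi_e\log|\varphi_e|^2$; the pairing of $L^2$-functions with $W(\Gamma)$ is $\mathrm{Re}\sum_e\int_0^\infty f_e\overline{v_e}\,dx$. *)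

(* Defs.v *)
From HB Require Import structures.
From mathcomp Require Import all_boot all_order all_algebra perm.
From mathcomp Require Import all_classical all_reals all_analysis.
Set Implicit Arguments. Unset Strict Implicit. Unset Printing Implicit Defensive.
Import Order.TTheory GRing.Theory Num.Theory.
Local Open Scope classical_set_scope.
Local Open Scope ring_scope.

Section StarGraph.
Variable R : realType.
Local Notation mu := (@lebesgue_measure R).

Definition halfline : set R := [set x | 0 < x].

Definition L2_half (u : R -> R) : Prop :=
  measurable_fun halfline u /\ mu.-integrable halfline (fun x => ((u x) ^+ 2)%:E).

(* g is a (weak) derivative of u on [0,oo): g in L^2(0,oo), locally integrable,
   and u(x) = u(0) + int_0^x g for all x >= 0 (absolutely continuous
   representative; u 0 is then the trace lim_{x->0+} u x). *)
Definition is_wderiv (u g : R -> R) : Prop :=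
  L2_half g /\
  forall x : R, 0 <= x ->
    mu.-integrable `[0, x] (fun t => (g t)%:E) /\
    u x = u 0 + Rintegral mu `[0, x] g.

Definition H1_half (u : R -> R) : Prop :=
  L2_half u /\ exists g, is_wderiv u g.

Definition H1_star (N : nat) (u : 'I_N -> R -> R) : Prop :=
  (forall e, H1_half (u e)) /\ (forall e e', u e 0 = u e' 0).

Definition W_star (N : nat) (u : 'I_N -> R -> R) : Prop :=
  H1_star u /\
  forall e, mu.-integrable halfline (fun x => ((u e x) ^+ 2 * ln ((u e x) ^+ 2))%:E).

(* weak formulation of  -Delta_gamma phi + omega phi - phi log|phi|^2 = 0 in W'(Gamma),
   tested against (real) v in W(Gamma); e1 is the first edge (vertex term uses u_1(0)). *)
Definition weak_stationary (N : nat) (e1 : 'I_N) (gamma omega : R)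
    (phi : 'I_N -> R -> R) : Prop :=
  forall (v : 'I_N -> R -> R), W_star v ->
  forall (dphi dv : 'I_N -> R -> R),
    (forall e, is_wderiv (phi e) (dphi e)) ->
    (forall e, is_wderiv (v e) (dv e)) ->
    \sum_(e < N)
       (Rintegral mu halfline (fun x => dphi e x * dv e x)
        + omega * Rintegral mu halfline (fun x => phi e x * v e x)
        - Rintegral mu halfline (fun x => phi e x * ln ((phi e x) ^+ 2) * v e x))
    - gamma * (phi e1 0 * v e1 0) = 0.

(* the explicit profiles phi^kappa_{omega,gamma}; edges i = 1..kappa are the
   0-based indices i < kappa *)
Definition h_kappa (N kappa : nat) (gamma : R) : R := gamma / (N - 2 * kappa)%N%:R.

Definition phi_kappa (N kappa : nat) (omega gamma : R) (i : 'I_N) (x : R) : R :=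
  if (i < kappa)%N then
    expR ((omega + 1) / 2) * expR (- (x - h_kappa N kappa gamma) ^+ 2 / 2)
  else
    expR ((omega + 1) / 2) * expR (- (x + h_kappa N kappa gamma) ^+ 2 / 2).

End StarGraph.

(* Main.v *)
Require Import Defs.
From HB Require Import structures.
From mathcomp Require Import all_boot all_order all_algebra perm.
From mathcomp Require Import all_classical all_reals all_analysis.
From mathcomp Require Import measurable_realfun.
From mathcomp Require Import ring lra zify.
Import Order.TTheory GRing.Theory Num.Theory.
Import numFieldNormedType.Exports.

(** On each edge, testing the weak equation against the piecewise linear [v]
    with [v' = 1_[0,x] - x 1_[0,1]] shows that [phi] is [C^1] on [0, oo) with
    derivative [q = c + int_0 F], where [F = omega phi - phi ln phi^2].  The
    energy [q^2 - (omega + 1) phi^2 + phi^2 ln phi^2] is constant on (0, oo)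
    and, thanks to [W], integrable there, so it vanishes.  With zero energy the
    equation gives [(q / phi)' = -1], i.e. [(ln phi)'' = -1], so
    [q = (b - x) phi], and the energy identity turns this into the Gaussian
    [phi = exp((omega + 1) / 2) exp(- (x - b)^2 / 2)].

    Integration by parts against an arbitrary test function leaves only the
    boundary terms of these Gaussians, so a tuple of them with a common vertex
    value is stationary iff [sum_e b_e = - gamma].  The common vertex value
    forces [b_e = h] or [b_e = - h]; if [k] edges carry [+ h] then
    [h (N - 2 k) = gamma]. *)

Set Implicit Arguments. Unset Strict Implicit. Unset Printing Implicit Defensive.
Local Open Scope classical_set_scope.
Local Open Scope ring_scope.

(** * Primitives of locally integrable functions *)

Section Primitive.
Variable R : realType.
Local Notation mu := (@lebesgue_measure R).
Local Notation L1 D f := (mu.-integrable D (fun x => (f x)%:E)).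
Implicit Types (f g h k u v : R -> R) (D : set R).

Lemma mem_itvcc (a b y : R) : (y \in `[a, b]%classic) = (a <= y <= b).
Proof. by rewrite mem_setE in_itv. Qed.

Lemma L1_ext D f g : measurable D -> (forall x, D x -> f x = g x) -> L1 D f -> L1 D g.
Proof. by move=> mD fg; apply: (@eq_integrable _ _ _ mu D mD) => x /set_mem Dx; rewrite fg. Qed.

Lemma L1D D f g : measurable D -> L1 D f -> L1 D g -> L1 D (fun x => f x + g x).
Proof. by move=> mD If Ig; exact: (@integrableD _ _ _ mu D mD _ _ If Ig). Qed.

Lemma L1B D f g : measurable D -> L1 D f -> L1 D g -> L1 D (fun x => f x - g x).
Proof. by move=> mD If Ig; exact: (@integrableB _ _ _ mu D mD _ _ If Ig). Qed.

Lemma L1Zl D c f : measurable D -> L1 D f -> L1 D (fun x => c * f x).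
Proof. by move=> mD If; exact: (@integrableZl _ _ _ mu D mD c _ If). Qed.

Lemma L1_measurable D f : L1 D f -> measurable_fun D f.
Proof. by move=> If; apply/measurable_EFinP; exact: (measurable_int mu If). Qed.

Lemma L1_restrict D f : measurable D -> L1 D f <-> L1 setT (f \_ D).
Proof.
by move=> mD; rewrite (@integrable_mkcond _ _ _ mu D _ mD) restrict_EFin.
Qed.

Lemma L1_le D f g : measurable D -> measurable_fun D f ->
  (forall x, D x -> `|f x| <= g x) -> L1 D g -> L1 D f.
Proof.
move=> mD mf fg; apply: (@le_integrable _ _ _ mu D mD); first exact/measurable_EFinP.
by move=> x Dx; rewrite /= lee_fin (le_trans (fg x Dx))// ler_norm.
Qed.

Lemma EFin_Rintegral D f : measurable D -> L1 D f ->
  (\int[mu]_(x in D) f x)%:E = (\int[mu]_(x in D) (f x)%:E)%E.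
Proof. by move=> mD If; rewrite fineK//; exact: (@integrable_fin_num _ _ _ mu D mD _ If). Qed.

(* Fubini on the triangle [0 <= y <= x <= X]. *)
Lemma Rintegral_triangle f g (X : R) :
  mu.-integrable `[0, X] (EFin \o f) -> mu.-integrable `[0, X] (EFin \o g) ->
  \int[mu]_(x in `[0, X]) (f x * \int[mu]_(y in `[0, x]) g y)
  = \int[mu]_(y in `[0, X]) (g y * \int[mu]_(x in `[y, X]) f x).
Proof.
move=> If Ig.
(* Extension by zero encodes the triangle in the integrand [K], so that Fubini applies on the whole
   product space. *)
pose f1 := f \_ `[0, X]; pose g1 := g \_ `[0, X].
have If1 : mu.-integrable setT (EFin \o f1).
  by move: If; rewrite integrable_mkcond//= restrict_EFin.
have Ig1 : mu.-integrable setT (EFin \o g1).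
  by move: Ig; rewrite integrable_mkcond//= restrict_EFin.
have mf1 : measurable_fun setT f1 by apply/measurable_EFinP; exact: (measurable_int mu If1).
have mg1 : measurable_fun setT g1 by apply/measurable_EFinP; exact: (measurable_int mu Ig1).
pose K (z : R * R) := if z.2 <= z.1 then f1 z.1 * g1 z.2 else 0.
have mK : measurable_fun setT (EFin \o K).
  apply/measurable_EFinP; apply: measurable_fun_if => //.
    exact: measurable_fun_ler.
  apply: measurable_funTS; apply: measurable_funM.
    exact: (measurableT_comp mf1).
  exact: (measurableT_comp mg1).
(* Tonelli: [|K (x, y)|] is at most [|f1 x| |g1 y|], whose double integral is a product of two
   finite integrals. *)
have IK : (mu \x mu)%E.-integrable setT (EFin \o K).
  apply/(@integrable12ltyP _ _ _ _ R mu mu (EFin \o K) mK).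
  apply: (@le_lt_trans _ _ (\int[mu]_x (`|f1 x|%:E * \int[mu]_y `|g1 y|%:E)))%E.
    apply: ge0_le_integral => //=.
    - by move=> x _; exact: integral_ge0.
    - apply: (@measurable_fun_fubini_tonelli_F _ _ _ _ _ mu (abse \o (EFin \o K))).
        exact: measurableT_comp.
      by move=> z; exact: abse_ge0.
    - apply: emeasurable_funM => //.
      by apply/measurable_EFinP; exact: measurableT_comp.
    move=> x _.
    rewrite -ge0_integralZl//=; last first.
      by apply/measurable_EFinP; exact: measurableT_comp.
    apply: ge0_le_integral => //=.
    - apply/measurable_EFinP; apply: measurableT_comp => //.
      apply: (@measurableT_comp _ _ _ _ _ _ K _ (pair x)) => //.
      exact/measurable_EFinP.
    - apply/measurable_EFinP; apply: measurable_funM => //.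
      exact: measurableT_comp.
    move=> y _; rewrite /K/=; case: ifP => _; rewrite lee_fin ?normrM//.
    by rewrite normr0 mulr_ge0.
  rewrite ge0_integralZr//=; last 2 first.
  - by apply/measurable_EFinP; exact: measurableT_comp.
  - exact: integral_ge0.
  have /integrableP[_ Lf] := If1; have /integrableP[_ Lg] := Ig1.
  apply: lte_mul_pinfty => //; first exact: integral_ge0.
  by rewrite ge0_fin_numE//; exact: integral_ge0.
have := Fubini IK; rewrite /=.
have E1 x : (\int[mu]_y (K (x, y))%:E = (f1 x * \int[mu]_(y in `[0%R, x]) g y)%:E)%E.
  rewrite /K /f1 /= patchE; case: ifPn => [|nx]; last first.
    rewrite mul0r; under eq_integral do rewrite mul0r if_same.
    by rewrite integral0.
  rewrite inE/= in_itv/= => /andP[x0 xX].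
  have Igx : mu.-integrable `[0, x] (EFin \o g).
    by apply: integrableS Ig => //; apply: subset_itvl; rewrite bnd_simp.
  rewrite EFinM EFin_Rintegral//.
  rewrite -integralZl// [in RHS]integral_mkcond; apply: eq_integral => y _.
  rewrite patchE mem_itvcc; case: leP => yx; last by rewrite andbF.
  rewrite /g1 patchE mem_itvcc (le_trans yx xX) !andbT.
  by case: ifP; rewrite ?mulr0.
have E2 y : (\int[mu]_x (K (x, y))%:E = (g1 y * \int[mu]_(x in `[y, X]) f x)%:E)%E.
  rewrite /K /g1 /= patchE; case: ifPn => [|ny]; last first.
    rewrite mul0r; under eq_integral do rewrite mulr0 if_same.
    by rewrite integral0.
  rewrite inE/= in_itv/= => /andP[y0 yX].
  have Ify : mu.-integrable `[y, X] (EFin \o f).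
    by apply: integrableS If => //; apply: subset_itvr; rewrite bnd_simp.
  rewrite EFinM EFin_Rintegral//.
  rewrite -integralZl// [in RHS]integral_mkcond; apply: eq_integral => x _.
  rewrite patchE mem_itvcc; case: leP => yx; last by [].
  rewrite /f1 patchE mem_itvcc (le_trans y0 yx)/=.
  by case: ifP; rewrite ?mul0r// mulrC.
under eq_integral do rewrite E1.
under [X in _ = X]eq_integral do rewrite E2.
move=> /(congr1 fine) EE.
rewrite Rintegral_mkcond [RHS]Rintegral_mkcond /Rintegral.
have W (a b : R -> R) : (fun x => a x * b x) \_ `[0, X] = (fun x => (a \_ `[0, X]) x * b x).
  by apply/funext => x; rewrite !patchE; case: ifP; rewrite ?mul0r.
by rewrite !W.
Qed.

(* [is_wderiv u g] unfolds to [L2_half g /\ primitive u g]. *)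
Definition primitive u g := forall x : R, 0 <= x ->
  mu.-integrable `[0, x] (EFin \o g) /\ u x = u 0 + \int[mu]_(t in `[0, x]) g t.

Lemma primitive_continuous u g (X : R) : primitive u g ->
  {within `[0, X], continuous u}.
Proof.
move=> P; have [X0|X0] := leP 0 X; last first.
  by rewrite set_itv_ge ?bnd_simp -?ltNge//; exact: continuous_subspace0.
have c := parameterized_integral_continuous X0 (P X X0).1.
have c2 : {within `[0, X], continuous (fun x => u 0 + parameterized_integral mu 0 x g)}.
  by move=> x; apply: cvgD; [exact: cvg_cst|exact: c].
apply: subspace_eq_continuous c2 => x; rewrite inE/= in_itv/= => /andP[x0 _].
by rewrite /from_subspace (P x x0).2.
Qed.

Lemma within_continuous_integrable u (X : R) :
  {within `[0, X], continuous u} -> mu.-integrable `[0, X] (EFin \o u).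
Proof. by move=> c; apply: continuous_compact_integrable => //; exact: segment_compact. Qed.

Lemma within_continuous_bounded u (X : R) :
  {within `[0, X], continuous u} -> [bounded u x | x in `[0, X]].
Proof.
move=> c; have /compact_bounded[M [Mr MM]] := continuous_compact c (@segment_compact R 0 X).
by exists M; split => // y yM x xX; apply: (MM y yM); exists x.
Qed.

Lemma within_continuous_integrableM u h (X : R) :
  {within `[0, X], continuous u} -> mu.-integrable `[0, X] (EFin \o h) ->
  mu.-integrable `[0, X] (EFin \o (fun x => u x * h x)).
Proof.
move=> c Ih; rewrite (_ : _ \o _ = (EFin \o u) \* (EFin \o h))%E//.
apply: integrableMr => //; last exact: within_continuous_bounded.
exact: subspace_continuous_measurable_fun.
Qed.

(** Integration by parts for absolutely continuous functions. In the integral of [g v], the factor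
    [v] is expanded as [v 0] plus the integral of [h]; the triangle identity swaps the order of
    integration, and the integral of [g] over [[t, x]] is [u x - u t]. *)
Lemma primitiveM u g v h : primitive u g -> primitive v h ->
  primitive (fun x => u x * v x) (fun x => u x * h x + g x * v x).
Proof.
move=> Pu Pv x x0.
have [Ig _] := Pu x x0; have [Ih _] := Pv x x0.
have cu := primitive_continuous (X := x) Pu; have cv := primitive_continuous (X := x) Pv.
have Iuh := within_continuous_integrableM cu Ih.
have Igv : mu.-integrable `[0, x] (EFin \o (fun t => g t * v t)).
  have := within_continuous_integrableM cv Ig.
  by apply: eq_integrable => // t _; rewrite /= mulrC.
split; first exact: L1D.
rewrite RintegralD//.
have IgV : L1 `[0, x] (fun t => g t * \int[mu]_(s in `[0, t]) h s).
  apply: L1_ext (L1B _ Igv (L1Zl (v 0) _ Ig)) => // t /=.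
  by rewrite in_itv/= => /andP[t0 _]; rewrite (Pv t t0).2; ring.
have tailE t : 0 <= t <= x -> \int[mu]_(s in `[t, x]) g s = u x - u t.
  move=> /andP[t0 tx]; rewrite -Rintegral_itv_obnd_cbnd; last first.
    by apply: integrableS Ig => //; apply: subset_itvScc; rewrite bnd_simp.
  by rewrite -(Rintegral_itvB Ig)// ?bnd_simp// (Pu t t0).2 (Pu x x0).2; ring.
have -> : \int[mu]_(t in `[0, x]) (g t * v t) =
    \int[mu]_(t in `[0, x]) (v 0 * g t) +
    \int[mu]_(t in `[0, x]) (g t * \int[mu]_(s in `[0, t]) h s).
  rewrite -RintegralD//; last exact: L1Zl.
  apply: eq_Rintegral => t; rewrite inE/= in_itv/= => /andP[t0 _].
  by rewrite (Pv t t0).2; ring.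
rewrite RintegralZl// Rintegral_triangle//.
have -> : \int[mu]_(y in `[0, x]) (h y * \int[mu]_(s in `[y, x]) g s) =
    u x * \int[mu]_(t in `[0, x]) h t - \int[mu]_(t in `[0, x]) (u t * h t).
  rewrite -RintegralZl// -RintegralB//; last exact: L1Zl.
  by apply: eq_Rintegral => t; rewrite inE/= in_itv/= => /tailE ->; ring.
by rewrite (Pu x x0).2 (Pv x x0).2; ring.
Qed.

(** The difference has zero integral over every [[0, y]], so by Lebesgue differentiation it vanishes
    almost everywhere. This allows an arbitrary weak derivative to be exchanged for an explicit or
    continuous one. *)
Lemma primitive_unique u g h : primitive u g -> primitive u h ->
  {ae mu, forall x, 0 < x -> g x = h x}.
Proof.
(* Nothing is known about [g] and [h] at negative arguments; the cut-off makes [d] locally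
   integrable on the whole line. *)
move=> Pg Ph; pose d := (fun x => g x - h x) \_ `[0, +oo[.
have dE y x : `[0, y]%classic x -> g x - h x = d x.
  rewrite /= in_itv/= => /andP[x0 _]; rewrite /d patchE ifT// inE/= in_itv/=.
  by rewrite x0.
have Id y : L1 `[0, y] d.
  have [y0|y0] := leP 0 y; last first.
    by rewrite set_itv_ge ?bnd_simp -?ltNge//; exact: integrable_set0.
  apply: (L1_ext _ (dE y)) => //; apply: L1B => //; [exact: (Pg y y0).1|exact: (Ph y y0).1].
have d0 y : \int[mu]_(x in `[0, y]) d x = 0.
  have [y0|y0] := leP 0 y; last first.
    by rewrite set_itv_ge ?bnd_simp -?ltNge// Rintegral_set0.
  rewrite -(@eq_Rintegral _ _ _ mu _ _ (fun x => g x - h x)); last first.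
    by move=> x /set_mem; exact: dE.
  rewrite RintegralB//; [|exact: (Pg y y0).1|exact: (Ph y y0).1].
  by have := (Pg y y0).2; rewrite (Ph y y0).2; lra.
have md : measurable_fun setT d.
  apply/measurable_restrict => //.
  rewrite (_ : _ `&` _ = \bigcup_n `[0, n%:R]%classic).
    apply/measurable_fun_bigcup => // n.
    by apply: (eq_measurable_fun d) (L1_measurable (Id n%:R)) => x /set_mem /dE.
  rewrite setTI; apply/seteqP; split => x /=; rewrite in_itv/=.
    rewrite andbT => x0; exists (Num.truncn x).+1 => //=.
    by rewrite in_itv/= x0 ltW// truncnS_gt.
  by move=> [n _ /=]; rewrite in_itv/= => /andP[->].
have ld : locally_integrable setT d.
  split => //; first exact: openT.
  move=> K _ cK; have [M [Mr MM]] := compact_bounded cK.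
  have KM : K `<=` `[- (`|M| + 1), `|M| + 1].
    move=> x Kx; rewrite /= in_itv/= -ler_norml; apply: MM => //.
    by rewrite (le_lt_trans (ler_norm M))// ltrDl.
  have /integrableP[_] := Id (`|M| + 1).
  apply: le_lt_trans; rewrite [leRHS]integral_mkcond [leLHS]integral_mkcond.
  have mK := compact_measurable cK.
  apply: ge0_le_integral => //.
  - by move=> x _; rewrite patchE; case: ifP.
  - apply/(measurable_restrictT _ _).1 => //; apply/measurable_EFinP.
    by apply: measurable_funTS; exact: measurableT_comp.
  - apply/(measurable_restrictT _ _).1 => //; apply/measurable_EFinP.
    by apply: measurable_funTS; exact: measurableT_comp.
  move=> x _; rewrite !patchE; case: ifPn => [|_]; last by case: ifP => // _; exact: abse_ge0.
  move=> /set_mem/KM; rewrite /= in_itv/= => /andP[_ xM].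
  case: ifPn => // /negP; rewrite inE/= in_itv/= xM andbT => x0.
  have -> : d x = 0.
    by rewrite /d patchE ifF//; apply/negP; rewrite inE/= in_itv/= andbT.
  by rewrite normr0.
have := FTC1 (a := BLeft 0) Id ld.
rewrite (_ : (fun x => _) = cst 0); last by apply/funext => x; rewrite d0.
move=> /=; apply: filterS; first exact: (ae_filter_ringOfSetsType mu).
move=> x dx x0; have [] := dx; first by rewrite lte_fin.
move=> _; rewrite derive1_cst => /esym; rewrite -(dE x) ?subr_eq0//.
  by move/eqP; rewrite subr_eq0 => /eqP.
by rewrite /= in_itv/= lexx ltW.
Qed.

Lemma primitive_C1 u g : (forall x, is_derive x (1 : R) u (g x)) -> continuous g ->
  primitive u g.
Proof.
move=> du cg x x0.
have cw : {within `[0, x], continuous g} by exact: continuous_subspaceT.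
split; first exact: within_continuous_integrable.
move: x0; rewrite le_eqVlt => /predU1P[<-|x0].
  by rewrite set_itv1 Rintegral_set1 addr0.
have cu : continuous u.
  by move=> y; apply: differentiable_continuous; apply/derivable1_diffP; case: (du y).
rewrite /Rintegral (continuous_FTC2 (F := u))//=; first lra.
- split; [by move=> y _; case: (du y)|..].
    by apply: cvg_at_right_filter; exact: cu.
  by apply: cvg_at_left_filter; exact: cu.
- by move=> y _; rewrite derive1E; apply: derive_val.
Qed.

End Primitive.

(** * Square-integrable functions on the half-line *)

Section HalfLine.
Variable R : realType.
Local Notation mu := (@lebesgue_measure R).
Local Notation L1 D f := (mu.-integrable D (fun x => (f x)%:E)).
Local Notation half := (@halfline R).
Implicit Types (f g h k u v : R -> R) (D : set R).

Lemma halflineE : half = `]0, +oo[%classic.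
Proof. by apply/seteqP; split => x /=; rewrite in_itv/= andbT. Qed.

Lemma measurable_halfline : measurable half.
Proof. by rewrite halflineE. Qed.
Hint Resolve measurable_halfline : core.

(** Nothing contributes beyond [X], and the endpoint 0 is a null set. This evaluates pairings with
    test functions of bounded support. *)
Lemma integral_halfline_cut f (X : R) : 0 <= X -> (forall x, X < x -> f x = 0) ->
  L1 `[0, X] f -> L1 half f /\ \int[mu]_(x in half) f x = \int[mu]_(x in `[0, X]) f x.
Proof.
move=> X0 fX If.
have IfO : L1 `]0, X] f.
  by apply: integrableS If => //; apply: subset_itvScc; rewrite bnd_simp.
have E : f \_ half = f \_ `]0, X].
  apply/funext => x; rewrite halflineE !patchE !mem_setE !in_itv/= andbT.
  by case: (ltP 0 x) => x0 //=; case: (leP x X) => // /fX ->.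
split.
  apply/(@L1_restrict R half f measurable_halfline); rewrite E.
  exact/(@L1_restrict R _ f (measurable_itv _)).
rewrite -Rintegral_itv_obnd_cbnd//.
by rewrite Rintegral_mkcond [RHS]Rintegral_mkcond E.
Qed.

(** Dominated convergence with majorant [|k|], applied to [|k|] cut off to [(n, oo)]. *)
Lemma integral_tail_small k (e : R) : L1 half k -> 0 < e -> exists2 n : R, 0 <= n &
  forall x, n <= x ->
    `|\int[mu]_(t in half) k t - \int[mu]_(t in `[0, x]) k t| < e.
Proof.
move=> Ik e0.
pose f_ (n : nat) (x : R) := `|k x| * (n%:R < x)%R%:R.
have mf n : measurable_fun half (f_ n).
  apply: measurable_funM; first by apply: measurableT_comp => //; exact: L1_measurable Ik.
  apply: (@measurableT_comp _ _ _ _ _ _ (fun b : bool => b%:R : R)) => //.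
  exact: measurable_fun_ltr.
have Ink : L1 half (fun x => `|k x|) by exact: integrable_norm.
have If n : L1 half (f_ n).
  apply: L1_le Ink => // x _; rewrite /f_ normrM normr_id.
  by case: ltP => _; rewrite ?normr1 ?normr0 ?mulr1 ?mulr0.
have [_ _ D] : [/\ mu.-integrable half (cst 0%E : R -> \bar R),
    [sequence \int[mu]_(x in half) `|(f_ n x)%:E - cst 0 x|]_n @ \oo --> 0 &
    [sequence \int[mu]_(x in half) (f_ n x)%:E]_n @ \oo -->
      \int[mu]_(x in half) (cst 0 x)]%E.
  apply: (@dominated_convergence _ _ _ mu half measurable_halfline _ _
    (fun x => `|k x|%:E)) => //.
  - by move=> n; apply/measurable_EFinP; exact: mf.
  - apply: aeW => x _; apply: cvg_near_cst; exists (Num.truncn x).+1 => // n /= xn.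
    rewrite /f_ ltNge (le_trans (ltW (Num.Theory.truncnS_gt x))) ?ler_nat//=.
    by rewrite mulr0.
  - apply: aeW => x n _; rewrite /= lee_fin /f_ normrM normr_id.
    by case: ltP => _; rewrite ?normr1 ?normr0 ?mulr1 ?mulr0.
rewrite integral0 in D.
have {}D : (fun n => \int[mu]_(x in half) f_ n x) @ \oo --> (0 : R) by exact: fine_cvg D.
move/cvgrPdist_lt : D => /(_ e e0)[N _ /(_ N (leqnn N))].
rewrite /= sub0r normrN => fN; exists N%:R; rewrite ?ler0n// => x Nx.
have x0 : 0 <= x by apply: le_trans Nx; rewrite ler0n.
pose kx t := k t * (t <= x)%R%:R.
have kxE t : t <= x -> kx t = k t by move=> tx; rewrite /kx tx mulr1.
(* [halfline] is open at 0; adjoining this single null point preserves integrability. *)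
have Ikc : L1 `[0, x] k.
  have IkO : L1 `]0, x] k.
    apply: integrableS Ik => // t /=.
    by rewrite in_itv/= /halfline/= => /andP[].
  have mIO : measurable_fun `[0, x] k.
    by apply/measurable_fun_itv_obnd_cbndP; exact: L1_measurable IkO.
  rewrite (@negligible_integrable _ _ _ mu _ [set 0])//.
  - apply: integrableS IkO => //; first exact: measurableD.
    move=> t [/=]; rewrite !in_itv/= => /andP[t0 ->] /eqP tn0.
    by rewrite andbT lt_neqAle t0 eq_sym tn0.
  - by apply/measurable_EFinP.
  - exact: lebesgue_measure_set1.
have Ikx : L1 `[0, x] kx.
  by apply: L1_ext Ikc => // t; rewrite /= in_itv/= => /andP[_ /kxE].
have kx0 t : x < t -> kx t = 0 by rewrite /kx ltNge => /negbTE ->; rewrite mulr0.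
have [Ikxh kxh] := integral_halfline_cut x0 kx0 Ikx.
have -> : \int[mu]_(t in `[0, x]) k t = \int[mu]_(t in half) kx t.
  rewrite kxh; apply: eq_Rintegral => t; rewrite mem_itvcc => /andP[_ tx].
  by rewrite kxE.
rewrite -RintegralB//; apply: le_lt_trans (le_normr_Rintegral _ (L1B _ Ik Ikxh)) _ => //.
apply: le_lt_trans fN; apply: le_trans (ler_norm _); apply: le_Rintegral => //.
- by apply: integrable_norm; exact: L1B.
- exact: If.
move=> t _; rewrite /kx /f_; case: (leP t x) => tx.
  by rewrite mulr1 subrr normr0 mulr_ge0// ler0n.
by rewrite mulr0 subr0 (le_lt_trans Nx tx) mulr1.
Qed.

(** The left-hand side is the limit of [u] at infinity. Were it nonzero, [|u|] would eventually stay
    above half its modulus, against integrability. This is how boundary terms at infinity are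
    discarded. *)
Lemma primitive_vanish u k : primitive u k -> L1 half u -> L1 half k ->
  u 0 + \int[mu]_(x in half) k x = 0.
Proof.
move=> Pu Iu Ik; apply/eqP; apply: contraT => L0.
set L := u 0 + _ in L0; pose e : R := `|L| / 2.
have e0 : 0 < e by rewrite divr_gt0 ?normr_gt0.
have [n n0 nP] := integral_tail_small Ik e0.
have eu x : n <= x -> e <= `|u x|.
  move=> nx; have /= := nP x nx; rewrite (Pu x (le_trans n0 nx)).2 => h.
  have : `|L| <= `|u 0 + \int[mu]_(t in `[0, x]) k t| +
      `|\int[mu]_(t in half) k t - \int[mu]_(t in `[0, x]) k t|.
    apply: le_trans (ler_normD _ _); rewrite le_eqVlt; apply/orP; left.
    by apply/eqP; congr (`|_|); rewrite /L; ring.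
  by move: h; rewrite /e; lra.
have Inu : L1 half (fun x => `|u x|) by exact: integrable_norm.
pose I := \int[mu]_(x in half) `|u x|.
have bound (m : R) : 0 <= m -> e * m <= I.
  move=> m0; suff : ((e * m)%:E <= I%:E)%E by rewrite lee_fin.
  rewrite /I EFin_Rintegral//.
  have sub : `]n, n + m] `<=` half.
    by move=> x /=; rewrite in_itv/= => /andP[nx _]; rewrite /halfline/= (le_lt_trans n0).
  have -> : (e * m)%:E = (\int[mu]_(x in `]n, (n + m)%R]) e%:E)%E.
    rewrite integral_cst//= lebesgue_measure_itv/= lte_fin ltrDl.
    case: ltP => m0'; first by rewrite -EFinD addrAC subrr add0r EFinM.
    by rewrite mule0; congr EFin; nra.
  have mnu : measurable_fun half (fun x => `|u x|%:E).
    by apply/measurable_EFinP; exact: L1_measurable Inu.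
  have H1 : (\int[mu]_(x in `]n, (n + m)%R]) e%:E <= \int[mu]_(x in `]n, (n + m)%R]) `|u x|%:E)%E.
    apply: ge0_le_integral => //=.
    + by move=> x _; rewrite lee_fin ltW.
    + exact: measurable_funS mnu.
    + by move=> x; rewrite in_itv/= => /andP[nx _]; rewrite lee_fin eu// ltW.
  have H2 : (\int[mu]_(x in `]n, (n + m)%R]) `|u x|%:E <= \int[mu]_(x in half) `|u x|%:E)%E.
    by apply: ge0_subset_integral => //=.
  exact: (le_trans H1 H2).
have I0 : 0 <= I by have := bound 0 (lexx _); rewrite mulr0.
(* The choice [m = (I + 1) / e] turns the bound into [I + 1 <= I]. *)
have := bound ((I + 1) / e); rewrite mulrCA divff ?gt_eqF// mulr1.
by move=> /(_ (divr_ge0 (addr_ge0 I0 ler01) (ltW e0))); lra.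
Qed.

Lemma primitive_ext u w g : (forall x, 0 <= x -> u x = w x) -> primitive u g -> primitive w g.
Proof. by move=> uw Pu x x0; have [Ig] := Pu x x0; rewrite !uw. Qed.

Lemma L2_ext f g : (forall x, 0 < x -> f x = g x) -> L2_half f -> L2_half g.
Proof.
move=> fg [mf If]; split.
  by apply: eq_measurable_fun mf => x /set_mem; exact: fg.
by apply: L1_ext If => // x /fg ->.
Qed.

Lemma L2_mul f g : L2_half f -> L2_half g -> L1 half (fun x => f x * g x).
Proof.
move=> [mf If] [mg Ig]; apply: L1_le (L1D measurable_halfline If Ig) => //.
  exact: measurable_funM.
move=> x _; rewrite ler_norml.
have := sqr_ge0 (f x - g x); have := sqr_ge0 (f x + g x); nra.
Qed.

(** Both branches of [phi_kappa] have this form with amplitude [exp((omega + 1) / 2)]: the centre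
    [b] is [h] on the first [kappa] edges and [- h] on the others. *)
Definition gauss (a b x : R) := a * expR (- (x - b) ^+ 2 / 2).

Lemma is_derive_gauss a b x : is_derive x (1 : R) (gauss a b) (- (x - b) * gauss a b x).
Proof.
rewrite /gauss; apply: is_derive_eq.
by rewrite /GRing.scale/=; field.
Qed.

Lemma is_derive_dgauss a b x :
  is_derive x (1 : R) (fun y => - (y - b) * gauss a b y) (((x - b) ^+ 2 - 1) * gauss a b x).
Proof.
have := is_derive_gauss a b x => dg.
apply: is_derive_eq; rewrite /GRing.scale/=; ring.
Qed.

Lemma continuous_expR_gauss b : continuous (fun x : R => expR (- (x - b) ^+ 2 / 2)).
Proof.
move=> x; have [dg _] := is_derive_gauss 1 b x.
have -> : (fun x : R => expR (- (x - b) ^+ 2 / 2)) = gauss 1 b.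
  by apply/funext => y; rewrite /gauss mul1r.
by apply: differentiable_continuous; exact/derivable1_diffP.
Qed.

(** With [y = (x - b)^2] the square is at most [C^2 (1 + y)^2 exp(- y)], which is dominated by a
    multiple of the normal density of mean [b] and variance 1, since that decays only like
    [exp(- y / 2)]. *)
Lemma L2_poly_gauss (p : R -> R) b C : continuous p ->
  (forall x, `|p x| <= C * (1 + (x - b) ^+ 2)) ->
  L2_half (fun x => p x * expR (- (x - b) ^+ 2 / 2)).
Proof.
move=> cp pC.
have m : measurable_fun setT (fun x => p x * expR (- (x - b) ^+ 2 / 2)).
  apply: continuous_measurable_fun => x.
  by apply: cvgM; [exact: cp|exact: continuous_expR_gauss].
split; first exact: measurable_funTS.
have In : L1 half (normal_pdf b 1).
  by apply: integrableS (integrable_normal_pdf b 1).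
apply: (L1_le (g := fun x => (16 * C ^+ 2 / normal_peak 1) * normal_pdf b 1 x)) => //.
- by apply: measurable_funTS; apply: measurable_funX.
- have npE y : normal_pdf b 1 y = normal_peak 1 * normal_fun b 1 y.
    by rewrite normal_pdfE ?oner_eq0.
  move=> x _; rewrite npE /normal_fun.
  rewrite ger0_norm ?sqr_ge0// mulrA divfK ?gt_eqF ?normal_peak_gt0 ?oner_eq0//.
  rewrite expr1n exprMn.
  set y := (x - b) ^+ 2.
  have y0 : 0 <= y by exact: sqr_ge0.
  rewrite -expRM_natl -[X in _ <= _ * expR X]/(- y / (1 *+ 2)).
  have -> : 2%:R * (- y / 2) = - y / (1 *+ 2) - y / 2 by field.
  rewrite expRD mulrCA [leRHS]mulrC ler_wpM2l ?expR_ge0//.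
  (* (1 + y)^2 <= 16 exp(y / 2), from 1 + y / 4 <= exp(y / 4) *)
  have e4 : 1 + y / 4 <= expR (y / 4) by exact: expR_ge1Dx.
  have e2 : expR (y / 2) = expR (y / 4) ^+ 2.
    by rewrite -expRM_natl; congr expR; field.
  rewrite expRN ler_pdivrMr ?expR_gt0// e2.
  have := pC x; rewrite -/y => pCx.
  have : p x ^+ 2 <= (C * (1 + y)) ^+ 2.
    by rewrite -[leLHS]real_normK ?num_real// lerXn2r ?nnegrE// (le_trans _ pCx).
  move=> /le_trans; apply.
  have -> : 16 * C ^+ 2 * expR (y / 4) ^+ 2 = C ^+ 2 * (16 * expR (y / 4) ^+ 2) by ring.
  by rewrite exprMn ler_wpM2l ?sqr_ge0//; nra.
- exact: L1Zl.
Qed.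

End HalfLine.

(** * Gaussian edges *)

Section GaussEdge.
Variable R : realType.
Local Notation mu := (@lebesgue_measure R).
Local Notation L1 D f := (mu.-integrable D (fun x => (f x)%:E)).
Local Notation half := (@halfline R).
Let measurable_half : measurable half := @measurable_halfline R.
Local Hint Resolve measurable_half : core.
Implicit Types (f g h k u v : R -> R) (D : set R) (a b c x : R).

Lemma L2_mul_gauss (p : R -> R) a b C : continuous p ->
  (forall x, `|p x| <= C * (1 + (x - b) ^+ 2)) -> L2_half (fun x => p x * gauss a b x).
Proof.
move=> cp pC.
have := @L2_poly_gauss R (fun x => p x * a) b (C * `|a|).
have cpa : continuous (fun x => p x * a).
  by move=> x; apply: cvgM; [exact: cp|exact: cvg_cst].
move=> /(_ cpa) H; apply: (L2_ext _ (H _)) => x; first by rewrite /gauss mulrA.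
by rewrite normrM mulrAC ler_wpM2r.
Qed.

Lemma continuous_shift b : continuous (fun x : R => x - b).
Proof. by move=> x; apply: cvgB; [exact: cvg_id|exact: cvg_cst]. Qed.

Lemma L2_gauss a b : L2_half (gauss a b).
Proof.
have c1 : continuous (fun _ : R => 1 : R) by move=> x; exact: cvg_cst.
apply: (L2_ext _ (@L2_mul_gauss _ a b 1 c1 _)) => x; first by rewrite mul1r.
by rewrite normr1 mul1r lerDl sqr_ge0.
Qed.

Lemma L2_dgauss a b : L2_half (fun x => - (x - b) * gauss a b x).
Proof.
apply: (@L2_mul_gauss _ _ _ 1) => x.
  by apply: cvgN; exact: continuous_shift.
rewrite mul1r normrN ler_norml; have := sqr_ge0 (x - b - 1); have := sqr_ge0 (x - b + 1).
nra.
Qed.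

(** Covers two functions at once: up to sign, the second derivative of a Gaussian ([c = 1]), and the
    nonlinear term [phi ln phi^2] ([c = omega + 1]). *)
Lemma L2_sqr_gauss a b c : L2_half (fun x => (c - (x - b) ^+ 2) * gauss a b x).
Proof.
apply: (@L2_mul_gauss _ _ _ (`|c| + 1)) => x.
  by apply: cvgB; [exact: cvg_cst|apply: cvgM; exact: continuous_shift].
have := sqr_ge0 (x - b); set y := _ ^+ 2 => y0.
have := normr_ge0 c; have := ler_norm c; have := ler_norm (- c); rewrite normrN => h1 h2 h3.
by rewrite ler_norml; nra.
Qed.

Lemma gauss_gt0 a b x : 0 < a -> 0 < gauss a b x.
Proof. by move=> a0; rewrite mulr_gt0// expR_gt0. Qed.

Lemma ln_sqr_gauss c b x : ln (gauss (expR c) b x ^+ 2) = 2 * c - (x - b) ^+ 2.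
Proof.
by rewrite /gauss -expRD -expRM_natl expRK; field.
Qed.

Lemma primitive_gauss a b : primitive (gauss a b) (fun x => - (x - b) * gauss a b x).
Proof.
apply: primitive_C1 => [x|x]; first exact: is_derive_gauss.
have [d _] := is_derive_dgauss a b x.
by apply: differentiable_continuous; exact/derivable1_diffP.
Qed.

Lemma primitive_dgauss a b :
  primitive (fun x => - (x - b) * gauss a b x) (fun x => ((x - b) ^+ 2 - 1) * gauss a b x).
Proof.
apply: primitive_C1 => [x|x]; first exact: is_derive_dgauss.
apply: cvgM; last first.
  have [d _] := is_derive_gauss a b x.
  by apply: differentiable_continuous; exact/derivable1_diffP.
by apply: cvgB; [apply: cvgM; exact: continuous_shift|exact: cvg_cst].
Qed.

(** * The weak form along one Gaussian edge *)

Section edge.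
Variables (omega b : R) (phi : R -> R).
Local Notation G := (gauss (expR ((omega + 1) / 2)) b).
Hypothesis phiE : forall x, 0 <= x -> phi x = G x.

Let phiE' x : 0 < x -> G x = phi x.
Proof. by move=> x0; rewrite phiE// ltW. Qed.

Let half_gt0 x : half x -> 0 < x. Proof. by []. Qed.

Let lnE x : 0 <= x -> ln (phi x ^+ 2) = omega + 1 - (x - b) ^+ 2.
Proof. by move=> x0; rewrite phiE// ln_sqr_gauss; field. Qed.

Lemma gauss_edge_H1 : H1_half phi.
Proof.
split; first exact: L2_ext phiE' (L2_gauss _ _).
exists (fun x => - (x - b) * G x); split; first exact: L2_dgauss.
by apply: primitive_ext (primitive_gauss _ _) => x /phiE.
Qed.

Let L2_philn : L2_half (fun x => phi x * ln (phi x ^+ 2)).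
Proof.
apply: L2_ext (L2_sqr_gauss (expR ((omega + 1) / 2)) b (omega + 1)) => x x0.
by rewrite lnE ?ltW// mulrC phiE'.
Qed.

Lemma gauss_edge_ln : L1 half (fun x => phi x ^+ 2 * ln (phi x ^+ 2)).
Proof.
apply: L1_ext (L2_mul gauss_edge_H1.1 L2_philn) => // x _.
by rewrite mulrA expr2.
Qed.

(** The derivative [q = - (x - b) G] satisfies [q' = omega phi - phi ln phi^2], so the integrand is
    [(q v)'] and only the boundary term [- q 0 * v 0] at the vertex survives, with
    [q 0 = b * G 0]. *)
Lemma gauss_edge_weak (dphi v dv : R -> R) : is_wderiv phi dphi ->
  L2_half v -> is_wderiv v dv ->
  \int[mu]_(x in half) (dphi x * dv x) + omega * \int[mu]_(x in half) (phi x * v x)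
  - \int[mu]_(x in half) (phi x * ln (phi x ^+ 2) * v x) = - (b * G 0 * v 0).
Proof.
move=> [L2dphi Pphi] L2v [L2dv Pv].
pose q x := - (x - b) * G x; pose k x := q x * dv x + ((x - b) ^+ 2 - 1) * G x * v x.
have L2q : L2_half q by exact: L2_dgauss.
have L2r : L2_half (fun x => ((x - b) ^+ 2 - 1) * G x).
  apply: L2_ext (L2_sqr_gauss (- expR ((omega + 1) / 2)) b 1) => x _.
  by rewrite /gauss; ring.
have Iqv := L2_mul L2q L2v; have Iqdv := L2_mul L2q L2dv; have Irv := L2_mul L2r L2v.
have Iphiv := L2_mul gauss_edge_H1.1 L2v; have Ilnv := L2_mul L2_philn L2v.
have Pk : primitive (fun x => q x * v x) k.
  exact: primitiveM (primitive_dgauss _ _) Pv.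
have Ik : L1 half k by exact: L1D.
have := primitive_vanish Pk Iqv Ik.
rewrite /k RintegralD//.
(* The given weak derivative agrees with the explicit one almost everywhere. *)
have -> : \int[mu]_(x in half) (dphi x * dv x) = \int[mu]_(x in half) (q x * dv x).
  congr fine; apply: ae_eq_integral => //.
  - exact: measurable_int (L2_mul L2dphi L2dv).
  - exact: measurable_int Iqdv.
  have Pq : primitive phi q by apply: primitive_ext (primitive_gauss _ _) => x /phiE.
  have := primitive_unique Pphi Pq.
  apply: filterS; first exact: (ae_filter_ringOfSetsType mu).
  by move=> x dq /half_gt0 x0; rewrite dq.
(* On this profile [ln phi^2 = omega + 1 - (x - b)^2], so the second derivative is exactly
   [omega phi - phi ln phi^2]. *)
have -> : \int[mu]_(x in half) (((x - b) ^+ 2 - 1) * G x * v x) =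
    omega * \int[mu]_(x in half) (phi x * v x)
    - \int[mu]_(x in half) (phi x * ln (phi x ^+ 2) * v x).
  rewrite -RintegralZl// -RintegralB//; last exact: L1Zl.
  apply: eq_Rintegral => x /set_mem/half_gt0 x0.
  by rewrite lnE ?ltW// -phiE'//; ring.
by rewrite /q sub0r opprK; lra.
Qed.

End edge.
End GaussEdge.

(** * Trapezoidal test functions *)

Section EdgeODE.
Variable R : realType.
Local Notation mu := (@lebesgue_measure R).
Local Notation L1 D f := (mu.-integrable D (fun x => (f x)%:E)).
Local Notation half := (@halfline R).
Let measurable_half : measurable half := @measurable_halfline R.
Local Hint Resolve measurable_half : core.
Implicit Types (f g h k u v : R -> R) (D : set R) (a b c x X : R).

(** For [s > 0], [ln s < s] gives the upper bound [s^2], and the same inequality at [1 / s] gives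
    the lower bound [- 1]. *)
Lemma mul_ln_bound (s : R) : `|s * ln s| <= s ^+ 2 + 1.
Proof.
(* [ln] takes the default value 0 at nonpositive arguments. *)
have [s0|s0] := leP s 0; first by rewrite ln0// mulr0 normr0 addr_ge0 ?sqr_ge0.
have h1 := ln_sublinear s0.
have := @ln_sublinear R s^-1; rewrite invr_gt0 lnV// => /(_ s0) h2.
have h3 : s * s^-1 = 1 by rewrite divff// gt_eqF.
rewrite ler_norml; apply/andP; split; last by nra.
have : s * - ln s <= s * s^-1 by rewrite ler_wpM2l// ltW.
by rewrite h3; nra.
Qed.

Lemma mul_ln_sqr_bound (s : R) : `|s * ln (s ^+ 2)| <= 2 * (s ^+ 2 + 1).
Proof.
have [->|s0] := eqVneq s 0; first by rewrite mul0r normr0 mulr_ge0 ?addr_ge0 ?sqr_ge0.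
have -> : ln (s ^+ 2) = 2 * ln `|s|.
  by rewrite -real_normK ?num_real// lnXn ?normr_gt0// mulr_natl.
rewrite mulrCA normrM normr_nat ler_wpM2l//.
have -> : `|s * ln `|s| | = `| `|s| * ln `|s| | by rewrite !normrM normr_id.
by rewrite -(real_normK (num_real s)) mul_ln_bound.
Qed.

Lemma Rintegral_step h c X : 0 <= c -> c <= X -> L1 `[0, X] h ->
  L1 `[0, X] (fun t => h t * (t <= c)%R%:R) /\
  \int[mu]_(t in `[0, X]) (h t * (t <= c)%R%:R) = \int[mu]_(t in `[0, c]) h t.
Proof.
move=> c0 cX Ih.
have m : measurable_fun `[0, X] (fun t : R => (t <= c)%R%:R : R).
  apply: (@measurableT_comp _ _ _ _ _ _ (fun b : bool => b%:R : R)) => //.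
  exact: measurable_fun_ler.
have I : L1 `[0, X] (fun t => h t * (t <= c)%R%:R).
  apply: (@L1_le _ _ _ (fun t => `|h t|)) => //.
  - by apply: measurable_funM => //; exact: L1_measurable Ih.
  - move=> t _; rewrite normrM.
    by case: (t <= c)%R; rewrite ?normr1 ?normr0 ?mulr1 ?mulr0.
  - exact: integrable_norm.
split => //.
have := @Rintegral_itvB _ _ (BLeft 0) (BRight X) c I; rewrite !bnd_simp => /(_ c0 cX).
have -> : \int[mu]_(t in `]c, X]) (h t * (t <= c)%R%:R) = 0.
  rewrite (@eq_Rintegral _ _ _ mu _ (fun=> 0)) ?Rintegral_cst ?mul0r// => t.
  by rewrite mem_setE in_itv/= => /andP[ct _]; rewrite leNgt ct mulr0.
move/eqP; rewrite subr_eq0 => /eqP ->.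
by apply: eq_Rintegral => t; rewrite mem_itvcc => /andP[_ ->]; rewrite mulr1.
Qed.

Lemma primitive_min c : 0 <= c ->
  primitive (fun y => Num.min c y) (fun t => (t <= c)%R%:R).
Proof.
move=> c0 y y0; rewrite (min_idPr c0) add0r.
have I1 X : L1 `[0, X] (fun=> 1 : R).
  by apply: within_continuous_integrable => x; exact: cvg_cst.
have int1 X : 0 <= X -> \int[mu]_(t in `[0, X]) (1 : R) = X.
  move=> X0; rewrite Rintegral_cst//= lebesgue_measure_itv/= lte_fin mul1r.
  by case: ltP => [_|X0']; rewrite -?EFinD/= ?subr0//; apply/eqP; rewrite eq_le X0 X0'.
have [cy|yc] := leP c y.
  have [I] := Rintegral_step c0 cy (I1 y).
  rewrite int1// => E; split; first by apply: L1_ext I => // t _; rewrite mul1r.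
  by rewrite -[LHS]E; apply: eq_Rintegral => t _; rewrite mul1r.
split.
  by apply: L1_ext (I1 y) => // t /=; rewrite in_itv/= => /andP[_ ty];
    rewrite (le_trans ty (ltW yc)).
rewrite -[LHS]int1//; apply: eq_Rintegral => t; rewrite mem_itvcc => /andP[_ ty].
by rewrite (le_trans ty (ltW yc)).
Qed.

Lemma primitiveB u g v h : primitive u g -> primitive v h ->
  primitive (fun x => u x - v x) (fun x => g x - h x).
Proof.
move=> Pu Pv x x0; have [Ig Eg] := Pu x x0; have [Ih Eh] := Pv x x0.
by split; [exact: L1B|rewrite RintegralB// Eg Eh; ring].
Qed.

Lemma primitiveZ u g c : primitive u g -> primitive (fun x => c * u x) (fun x => c * g x).
Proof.
move=> Pu x x0; have [Ig Eg] := Pu x x0.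
by split; [exact: L1Zl|rewrite RintegralZl// Eg; ring].
Qed.

Section trapezoid.
Variable x : R.
Hypothesis x0 : 0 <= x.
Let X := Num.max 1 x.
Let X0 : 0 <= X. Proof. by rewrite /X le_max ler01. Qed.
Let xX : x <= X. Proof. by rewrite /X le_max lexx orbT. Qed.
Let X1 : 1 <= X. Proof. by rewrite /X le_max lexx. Qed.

(* Vanishes at 0 and beyond [max 1 x], with derivative [1_[0,x] - x 1_[0,1]]. *)
Definition trapezoid y := Num.min x y - x * Num.min 1 y.
Definition dtrapezoid t := (t <= x)%R%:R - x * (t <= 1)%R%:R : R.

Lemma trapezoid0 : trapezoid 0 = 0.
Proof. by rewrite /trapezoid (min_idPr x0) (min_idPr ler01) mulr0 subrr. Qed.

Lemma trapezoid_out y : Num.max 1 x <= y -> trapezoid y = 0.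
Proof.
move=> Xy; rewrite /trapezoid (min_idPl (le_trans xX Xy)).
by rewrite (min_idPl (le_trans X1 Xy)) mulr1 subrr.
Qed.

Lemma dtrapezoid_out y : Num.max 1 x < y -> dtrapezoid y = 0.
Proof.
move=> Xy; rewrite /dtrapezoid !leNgt (le_lt_trans xX Xy) (le_lt_trans X1 Xy)/=.
by rewrite mulr0 subrr.
Qed.

Lemma primitive_trapezoid : primitive trapezoid dtrapezoid.
Proof.
by apply: primitiveB; [exact: primitive_min|apply: primitiveZ; exact: primitive_min].
Qed.

Let cw : {within `[0, X], continuous trapezoid}.
Proof. exact: primitive_continuous primitive_trapezoid. Qed.

Lemma L2_trapezoid : L2_half trapezoid.
Proof.
have ct : continuous trapezoid.
  move=> y; rewrite /trapezoid; apply: cvgB.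
    by apply: continuous_min; [exact: cvg_cst|exact: cvg_id].
  by apply: cvgM; [exact: cvg_cst|apply: continuous_min; [exact: cvg_cst|exact: cvg_id]].
split; first by apply: measurable_funTS; exact: continuous_measurable_fun.
have [] // := @integral_halfline_cut R (fun y => trapezoid y ^+ 2) X X0 _ _.
  by move=> y /ltW/trapezoid_out ->; rewrite expr0n.
by apply: within_continuous_integrableM; [exact: cw|exact: within_continuous_integrable].
Qed.

Lemma wderiv_trapezoid : is_wderiv trapezoid dtrapezoid.
Proof.
split; last exact: primitive_trapezoid.
have m : measurable_fun setT dtrapezoid.
  apply: measurable_funB.
    apply: (@measurableT_comp _ _ _ _ _ _ (fun b : bool => b%:R : R)) => //.
    exact: measurable_fun_ler.
  apply: measurable_funM => //.
  apply: (@measurableT_comp _ _ _ _ _ _ (fun b : bool => b%:R : R)) => //.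
  exact: measurable_fun_ler.
split; first exact: measurable_funTS.
have [] // := @integral_halfline_cut R (fun y => dtrapezoid y ^+ 2) X X0 _ _.
  by move=> y /dtrapezoid_out ->; rewrite expr0n.
apply: (@L1_le _ _ _ (fun=> (1 + x) ^+ 2)) => //.
- by apply: measurable_funTS; exact: measurable_funX.
- move=> t _; rewrite ger0_norm ?sqr_ge0//.
  rewrite -[leLHS]real_normK ?num_real// lerXn2r ?nnegrE ?addr_ge0//.
  rewrite /dtrapezoid ler_norml; have := x0.
  by case: (t <= x)%R; case: (t <= 1)%R => /=; rewrite ?mulr1 ?mulr0; lra.
- by apply: within_continuous_integrable => y; exact: cvg_cst.
Qed.

(** On the bounded support, [mul_ln_bound] at [w^2] dominates the integrand by [w^4 + 1], which is
    continuous there. *)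
Lemma ln_trapezoid : L1 half (fun y => trapezoid y ^+ 2 * ln (trapezoid y ^+ 2)).
Proof.
have [] // := @integral_halfline_cut R (fun y => trapezoid y ^+ 2 * ln (trapezoid y ^+ 2)) X X0 _ _.
  by move=> y /ltW/trapezoid_out ->; rewrite expr0n mul0r.
have It := within_continuous_integrable cw.
have It2 := within_continuous_integrableM cw It.
have It3 := within_continuous_integrableM cw It2.
have It4 := within_continuous_integrableM cw It3.
have I1 : L1 `[0, X] (fun=> 1 : R).
  by apply: within_continuous_integrable => y; exact: cvg_cst.
have mt := L1_measurable It.
apply: L1_le (L1D _ It4 I1) => //.
- apply: measurable_funM; first exact: measurable_funX.
  apply: (@measurableT_comp _ _ _ _ _ _ (@ln R)); first exact: measurable_ln.
  exact: measurable_funX.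
- move=> t _; set w := trapezoid t.
  have -> : w * (w * (w * w)) = (w ^+ 2) ^+ 2 by ring.
  exact: mul_ln_bound.
Qed.

End trapezoid.

End EdgeODE.

(** * Positive solutions on one edge *)

Section EdgeSolution.
Variable R : realType.
Local Notation mu := (@lebesgue_measure R).
Local Notation L1 D f := (mu.-integrable D (fun x => (f x)%:E)).
Local Notation half := (@halfline R).
Let measurable_half : measurable half := @measurable_halfline R.
Local Hint Resolve measurable_half : core.
Implicit Types (f g h k u v : R -> R) (D : set R) (a b c x y t X : R).

Lemma primitive_continuous_at u g x : primitive u g -> 0 < x -> {for x, continuous u}.
Proof.
move=> Pu x0; have x1 : 0 < x + 1 by rewrite addr_gt0.
apply: (within_continuous_continuous x1); first exact: primitive_continuous Pu.
by rewrite in_itv/= x0 ltrDl ltr01.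
Qed.

Lemma primitive_is_derive u g x : primitive u g -> 0 < x -> {for x, continuous g} ->
  is_derive x (1 : R) u (g x).
Proof.
move=> Pu x0 cg; have xx1 : x < x + 1 by rewrite ltrDl.
have [Ig _] := Pu (x + 1) (addr_ge0 (ltW x0) ler01).
have [dG G'] := continuous_FTC1_closed xx1 Ig x0 cg.
pose v y := u 0 + \int[mu]_(t in `[0, y]) g t.
have dv : is_derive x (1 : R) v (g x).
  have dG' : is_derive x (1 : R) (fun y => \int[mu]_(t in `[0, y]) g t) (g x).
    by apply: (DeriveDef dG); rewrite -derive1E; exact: G'.
  rewrite -[g x]add0r; exact: is_deriveD.
(* [u] is known to equal [v] only at nonnegative arguments, which suffices near [x > 0]. *)
apply: near_eq_is_derive dv; near=> y.
rewrite /v -(Pu y _).2//; near: y.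
by apply: filterS (lt_nbhsr x0) => y /ltW.
Unshelve. all: by end_near. Qed.

Lemma is_derive0_cst f x X : (forall y, 0 < y -> is_derive y (1 : R) f 0) ->
  0 < x -> 0 < X -> f x = f X.
Proof.
move=> df; wlog xX : x X / x <= X => [hw x0 X0|x0 X0].
  by have [xX|/ltW Xx] := leP x X; [exact: hw|apply/esym/hw].
have [y /[!in_itv]/= /andP[xy yX]|c|c _] := @MVT_segment R f (fun=> 0) x X xX.
- by apply: df; rewrite (lt_trans x0).
- apply: derivable_within_continuous => y /[!in_itv]/= /andP[xy _].
  by have [] := df y (lt_le_trans x0 xy).
by rewrite mul0r => /eqP; rewrite subr_eq0 => /eqP.
Qed.

Section edge.
Variables (omega : R) (phi dphi : R -> R).
Hypothesis phi_gt0 : forall x, 0 < x -> 0 < phi x.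
Hypothesis L2phi : L2_half phi.
Hypothesis dphiP : is_wderiv phi dphi.
Hypothesis lnphi : L1 half (fun x => phi x ^+ 2 * ln (phi x ^+ 2)).
(** The equation seen by a single edge: a test function vanishing at the vertex extends by zero to
    the other edges and makes the vertex term disappear. *)
Hypothesis weak : forall v dv : R -> R, L2_half v -> is_wderiv v dv ->
  L1 half (fun x => v x ^+ 2 * ln (v x ^+ 2)) -> v 0 = 0 ->
  \int[mu]_(x in half) (dphi x * dv x) + omega * \int[mu]_(x in half) (phi x * v x)
  - \int[mu]_(x in half) (phi x * ln (phi x ^+ 2) * v x) = 0.

Let F x := omega * phi x - phi x * ln (phi x ^+ 2).

Let Pphi : primitive phi dphi := dphiP.2.

Let I_philn X : L1 `[0, X] (fun x => phi x * ln (phi x ^+ 2)).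
Proof.
have c := primitive_continuous (X := X) Pphi.
have I := within_continuous_integrable c.
have I1 : L1 `[0, X] (fun=> 1 : R).
  by apply: within_continuous_integrable => y; exact: cvg_cst.
have mt := L1_measurable I.
apply: L1_le (L1Zl 2 _ (L1D _ (within_continuous_integrableM c I) I1)) => //.
  apply: measurable_funM => //.
  apply: (@measurableT_comp _ _ _ _ _ _ (@ln R)); first exact: measurable_ln.
  exact: measurable_funX.
by move=> t _; rewrite -expr2; exact: mul_ln_sqr_bound.
Qed.

Let I_F X : L1 `[0, X] F.
Proof.
apply: L1B => //; apply: L1Zl => //.
by apply: within_continuous_integrable; exact: primitive_continuous Pphi.
Qed.

Let G y := \int[mu]_(t in `[0, y]) F t.

Let PG : primitive G F.
Proof. by move=> y y0; split => //; rewrite /G set_itv1 Rintegral_set1 add0r. Qed.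

(** The slope of [phi] at the vertex, fixed by requiring that [phi] have derivative [c0 + G] and
    take the right value at 1. *)
Let c0 := phi 1 - phi 0 - \int[mu]_(t in `[0, 1]) G t.

(** For the trapezoid [w], integration by parts replaces the integral of [F w] by minus that of
    [G w']. The equation then says that [dphi - G] is orthogonal to [w' = 1_[0,x] - x 1_[0,1]]: its
    integral over [[0, x]] is [x] times its integral over [[0, 1]], which is [c0]. *)
Let phi_increment x : 0 <= x -> phi x = phi 0 + c0 * x + \int[mu]_(t in `[0, x]) G t.
Proof.
move=> x0; pose X := Num.max 1 x.
have X0 : 0 <= X by rewrite /X le_max ler01.
have xX : x <= X by rewrite /X le_max lexx orbT.
have X1 : 1 <= X by rewrite /X le_max lexx.
have := weak (L2_trapezoid x0) (wderiv_trapezoid x0) (ln_trapezoid x0) (trapezoid0 x0).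
have step h : L1 `[0, X] h -> L1 `[0, X] (fun t => h t * dtrapezoid x t) /\
    \int[mu]_(t in `[0, X]) (h t * dtrapezoid x t) =
    \int[mu]_(t in `[0, x]) h t - x * \int[mu]_(t in `[0, 1]) h t.
  move=> Ih; have [Ix Ex] := Rintegral_step x0 xX Ih.
  have [I1 E1] := Rintegral_step ler01 X1 Ih.
  split.
    by apply: L1_ext (L1B _ Ix (L1Zl x _ I1)) => // t _; rewrite /dtrapezoid; ring.
  rewrite -Ex -E1 -RintegralZl// -RintegralB//; last exact: L1Zl.
  by apply: eq_Rintegral => t _; rewrite /dtrapezoid; ring.
have cG := primitive_continuous (X := X) PG.
have [Id Ed] := step dphi (Pphi X0).1.
have [IG EG] := step G (within_continuous_integrable cG).
have cut h : L1 `[0, X] (fun t => h t * trapezoid x t) ->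
    L1 half (fun t => h t * trapezoid x t) /\
    \int[mu]_(t in half) (h t * trapezoid x t) = \int[mu]_(t in `[0, X]) (h t * trapezoid x t).
  apply: integral_halfline_cut => // t /ltW Xt.
  by rewrite trapezoid_out// mulr0.
have ct := primitive_continuous (X := X) (primitive_trapezoid x0).
have It h : L1 `[0, X] h -> L1 `[0, X] (fun t => h t * trapezoid x t).
  move=> Ih; apply: L1_ext (within_continuous_integrableM ct Ih) => // t _.
  by rewrite mulrC.
have Ip := It _ (within_continuous_integrable (primitive_continuous (X := X) Pphi)).
have [_ Ep] := cut _ Ip; have [_ El] := cut _ (It _ (I_philn X)).
have outD t : X < t -> dphi t * dtrapezoid x t = 0.
  by move=> Xt; rewrite dtrapezoid_out// mulr0.
have [_ ->] := integral_halfline_cut X0 outD Id.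
have key : omega * \int[mu]_(t in `[0, X]) (phi t * trapezoid x t) -
    \int[mu]_(t in `[0, X]) (phi t * ln (phi t ^+ 2) * trapezoid x t) =
    \int[mu]_(t in `[0, X]) (F t * trapezoid x t).
  rewrite -RintegralZl// -RintegralB//; [|exact: L1Zl|exact: It].
  by apply: eq_Rintegral => t _; rewrite /F; ring.
rewrite Ed Ep El -addrA key.
(* No boundary term remains: [G] vanishes at 0 and the trapezoid vanishes at [X]. *)
have := (primitiveM PG (primitive_trapezoid x0) X0).2.
rewrite trapezoid_out// mulr0 /G set_itv1 Rintegral_set1 mul0r add0r -/G.
rewrite RintegralD//; last exact: It.
rewrite EG => E1 E2.
by rewrite /c0 (Pphi x0).2 (Pphi ler01).2; lra.
Qed.

(* The continuous representative of [dphi]. *)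
Let q x := c0 + G x.

Let PqF : primitive q F.
Proof. by move=> y y0; have [I E] := PG y0; split => //; rewrite /q E; ring. Qed.

Let Pphiq : primitive phi q.
Proof.
move=> y y0; have I1 : L1 `[0, y] (fun=> c0).
  by apply: within_continuous_integrable => z; exact: cvg_cst.
have IG := within_continuous_integrable (primitive_continuous (X := y) PG).
split; first exact: L1D.
rewrite (phi_increment y0) RintegralD// Rintegral_cst//= lebesgue_measure_itv/= lte_fin.
move: y0; rewrite le_eqVlt => /predU1P[<-|y0]; first by rewrite ltxx/=; ring.
by rewrite y0/=; ring.
Qed.

Let dphi_q x : 0 < x -> is_derive x (1 : R) phi (q x).
Proof.
move=> x0; apply: (primitive_is_derive Pphiq x0).
exact: primitive_continuous_at PqF x0.
Qed.

Let dlnphi x : 0 < x -> is_derive x (1 : R) (@ln R \o phi) (q x / phi x).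
Proof.
move=> x0; have := is_derive1_comp (is_derive1_ln (phi_gt0 x0)) (dphi_q x0).
by rewrite mulrC.
Qed.

Let FE x : 0 < x -> F x = omega * phi x - 2 * (phi x * ln (phi x)).
Proof.
by move=> x0; rewrite /F lnXn ?phi_gt0// -mulr_natl; ring.
Qed.

Let dq_F x : 0 < x -> is_derive x (1 : R) q (omega * phi x - 2 * (phi x * ln (phi x))).
Proof.
move=> x0; rewrite -(FE x0); apply: (primitive_is_derive PqF x0).
have cphi := primitive_continuous_at Pphi x0.
apply: cvgB; first by apply: cvgM; [exact: cvg_cst|exact: cphi].
apply: cvgM; first exact: cphi.
apply: (@continuous_comp _ _ _ (fun y => phi y ^+ 2) (@ln R)).
  by apply: cvgM; exact: cphi.
by apply: continuous_ln; rewrite exprn_gt0// phi_gt0.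
Qed.

(** Measurability comes from continuity, the integral bound from almost everywhere equality with
    [dphi]. *)
Let L2q : L2_half q.
Proof.
have aeq := primitive_unique Pphi Pphiq.
have mq : measurable_fun half q.
  rewrite halflineE; apply: open_continuous_measurable_fun => // x.
  rewrite inE/= in_itv/= andbT => x0; exact: primitive_continuous_at PqF x0.
split => //.
have [[md /integrableP[_ Id]] _] := dphiP.
apply/integrableP; split; first by apply/measurable_EFinP; exact: measurable_funX.
apply: le_lt_trans Id; rewrite le_eqVlt; apply/orP; left; apply/eqP.
apply: ae_eq_integral => //.
- apply: measurableT_comp => //; apply/measurable_EFinP; exact: measurable_funX.
- apply: measurableT_comp => //; apply/measurable_EFinP; exact: measurable_funX.
apply: filterS aeq; first exact: (ae_filter_ringOfSetsType mu).
by move=> x dq x0; rewrite dq.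
Qed.

(* The energy, with [ln (phi ^ 2)] written [2 * ln phi]. *)
Let E x := q x ^+ 2 - (omega + 1) * phi x ^+ 2 + phi x ^+ 2 * (2 * ln (phi x)).

(** The derivative factors as [2 q (q' - F)]. *)
Let dE x : 0 < x -> is_derive x (1 : R) E 0.
Proof.
move=> x0; have d1 := dphi_q x0; have d2 := dq_F x0; have d3 := dlnphi x0.
have phi0 : phi x != 0 by rewrite gt_eqF// phi_gt0.
rewrite (_ : E = q ^+ 2 - (omega + 1) \*: phi ^+ 2 + phi ^+ 2 * (2 \*: (@ln R \o phi))).
  apply: is_derive_eq; rewrite !fctE /GRing.scale/=.
  by have -> : 2 *: ln (phi x) = 2 * ln (phi x) :> R by []; field.
by apply/funext => y.
Qed.

(** [E] is constant and, being built from [q^2], [phi^2] and [phi^2 ln phi^2], integrable on a set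
    of infinite length. A constant is a primitive of 0, so [primitive_vanish] forces the value 0. *)
Let E0 x : 0 < x -> E x = 0.
Proof.
move=> x0.
have EE y : 0 < y -> E y = E x by move=> y0; exact: is_derive0_cst dE y0 x0.
have IE : L1 half (fun=> E x).
  apply: L1_ext (L1D _ (L1B _ L2q.2 (L1Zl (omega + 1) _ L2phi.2)) lnphi) => // y y0.
  rewrite -(EE y y0) /E lnXn ?phi_gt0// -mulr_natl.
  by ring.
have P0 : primitive (fun=> E x) (fun=> 0).
  move=> y y0; split; last by rewrite Rintegral_cst// mul0r addr0.
  by apply: within_continuous_integrable => z; exact: cvg_cst.
have := primitive_vanish P0 IE (L1_ext _ (fun _ _ => mul0r _) (L1Zl 0 _ IE)).
by rewrite Rintegral_cst// mul0r addr0; exact.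
Qed.

(** [q / phi] is the logarithmic derivative, equal to [b - x] for a Gaussian centred at [b]; thus
    [r] should be constant and equal to the centre. *)
Let r x := q x * (phi x)^-1 + x.

Let dr x : 0 < x -> is_derive x (1 : R) r 0.
Proof.
move=> x0; have d1 := dphi_q x0; have d2 := dq_F x0.
have phi0 : phi x != 0 by rewrite gt_eqF// phi_gt0.
have d3 := is_deriveV phi0 d1.
rewrite (_ : r = q * (fun y => (phi y)^-1) + id); last by apply/funext => y.
apply: is_derive_eq; rewrite /GRing.scale/=.
have := E0 x0; rewrite /E => Ex.
(* Zero energy eliminates [q^2]; the logarithms then cancel against those of [q']. *)
have -> : q x * (- phi x ^- 2 * q x) = - phi x ^- 2 * ((omega + 1) * phi x ^+ 2 -
  phi x ^+ 2 * (2 * ln (phi x))).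
  have -> : (omega + 1) * phi x ^+ 2 - phi x ^+ 2 * (2 * ln (phi x)) = q x ^+ 2 by lra.
  by ring.
by field.
Qed.

Lemma edge_solution : exists b, forall x, 0 <= x ->
  phi x = gauss (expR ((omega + 1) / 2)) b x.
Proof.
pose b := r 1; exists b.
have qE x : 0 < x -> q x = - (x - b) * phi x.
  move=> x0; rewrite /b -(is_derive0_cst dr x0 ltr01) /r.
  by field; rewrite gt_eqF// phi_gt0.
have phiE x : 0 < x -> phi x = gauss (expR ((omega + 1) / 2)) b x.
  move=> x0; have := E0 x0; rewrite /E qE// => Ex.
  have p0 := phi_gt0 x0.
  (* With [q = (b - x) phi] the energy has the factor [phi^2]; the other factor determines
     [ln phi]. *)
  have : phi x ^+ 2 * ((x - b) ^+ 2 - (omega + 1) + 2 * ln (phi x)) = 0 by rewrite -[RHS]Ex; ring.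
  move/eqP; rewrite mulf_eq0 gt_eqF ?exprn_gt0//= => /eqP lnE.
  rewrite -[LHS]lnK ?posrE// /gauss -expRD; congr expR; lra.
(* Positivity is assumed only on the open half-line, so the value at 0 is recovered from the value
   at 1 and the common derivative on [(0, 1]]. *)
have phi0 : phi 0 = gauss (expR ((omega + 1) / 2)) b 0.
  have := (Pphiq ler01).2; rewrite phiE//.
  have := (primitive_gauss (expR ((omega + 1) / 2)) b ler01).2 => -> .
  have -> : \int[mu]_(t in `[0, 1]) q t =
      \int[mu]_(t in `[0, 1]) (- (t - b) * gauss (expR ((omega + 1) / 2)) b t).
    have IO h : L1 `[0, 1] h -> L1 `]0, 1] h.
      by apply: integrableS => //; apply: subset_itvScc; rewrite bnd_simp.
    have Iq := IO _ (Pphiq ler01).1.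
    have Ig := IO _ (primitive_gauss (expR ((omega + 1) / 2)) b ler01).1.
    rewrite -Rintegral_itv_obnd_cbnd// -[RHS]Rintegral_itv_obnd_cbnd//.
    apply: eq_Rintegral => t; rewrite mem_setE in_itv/= => /andP[t0 _].
    by rewrite qE// phiE.
  by lra.
by move=> x; rewrite le_eqVlt => /predU1P[<-|/phiE].
Qed.

End edge.
End EdgeSolution.

(** * Stationary states of the star graph *)

Section StarGraph.
Variable R : realType.
Local Notation mu := (@lebesgue_measure R).
Local Notation L1 D f := (mu.-integrable D (fun x => (f x)%:E)).
Local Notation half := (@halfline R).
Let measurable_half : measurable half := @measurable_halfline R.
Local Hint Resolve measurable_half : core.
Implicit Types (f g h k u v : R -> R) (D : set R) (a b c x y t X : R).

Lemma L1_zero D : measurable D -> L1 D (fun=> 0 : R).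
Proof. by move=> mD; exact: integrable0. Qed.

Lemma L2_zero : L2_half (fun=> 0 : R).
Proof.
split; first exact: measurable_cst.
by apply: L1_ext (L1_zero measurable_half) => // x _; rewrite expr0n.
Qed.

Lemma wderiv_zero : is_wderiv (fun=> 0 : R) (fun=> 0).
Proof.
split; first exact: L2_zero.
by move=> x x0; split; [exact: L1_zero|rewrite Rintegral_cst// mul0r addr0].
Qed.

(** * Counting and reordering edges by the sign of their centre *)

Lemma sum_signs (N : nat) (P : pred 'I_N) (h : R) :
  \sum_(i < N) (if P i then h else - h) = h * (2 * #|P|%:R - N%:R).
Proof.
rewrite (eq_bigr (fun i => - h + (if P i then 2 * h else 0))); last first.
  by move=> i _; case: (P i); ring.
rewrite big_split/= -big_mkcond !sumr_const/= card_ord.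
by rewrite -(mulr_natr (- h)) -(mulr_natr (2 * h)); ring.
Qed.

Lemma card_ord_lt (N k : nat) : (k <= N)%N -> #|[pred i : 'I_N | (i < k)%N]| = k.
Proof.
by move=> kN; rewrite -sum1_card -(big_ord_widen _ (fun=> 1%N) kN) sum1_card card_ord.
Qed.

(** List the elements of [P] first and the others after; the permutation sends an edge to its
    position in this list. *)
Lemma perm_initial_segment (N : nat) (P : pred 'I_N) :
  exists s : {perm 'I_N}, forall i, (s i < #|P|)%N = P i.
Proof.
pose e := enum P ++ enum (predC P).
have ein i : i \in e by rewrite mem_cat !mem_enum !inE; exact: orbN.
have se : size e = N.
  by rewrite size_cat -!cardE cardC card_ord.
have lt_e i : (index i e < N)%N by rewrite -[X in (_ < X)%N]se index_mem.
pose f i := Ordinal (lt_e i).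
have fI : injective f.
  move=> i j /(congr1 val)/= ij.
  by rewrite -(nth_index i (ein i)) ij nth_index.
exists (perm fI) => i; rewrite permE /= index_cat cardE mem_enum.
case: ifPn => [Pi|nPi]; last by rewrite ltnNge leq_addr; apply/esym/negbTE.
by rewrite index_mem mem_enum Pi.
Qed.

Section fixed.
Variables (N : nat) (hN : (1 < N)%N) (gamma omega : R).
Hypothesis hgamma : 0 < gamma.
Local Notation e1 := (Ordinal (ltnW hN)).
Local Notation A := (expR ((omega + 1) / 2)).
Local Notation G b := (gauss A b).

Let A0 : 0 < A. Proof. exact: expR_gt0. Qed.

Lemma gauss_star_W (b : 'I_N -> R) (phi : 'I_N -> R -> R) :
  (forall e x, 0 <= x -> phi e x = G (b e) x) ->
  (forall e e', phi e 0 = phi e' 0) -> W_star phi.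
Proof.
move=> phiE phi0; split; first by split => // e; exact: gauss_edge_H1 (phiE e).
by move=> e; exact: gauss_edge_ln (phiE e).
Qed.

(** Each edge contributes [- b e] times the product of the vertex values, which continuity makes
    common to all edges. Stationarity is thus reduced to one scalar condition on the centres. *)
Lemma gauss_star_weak (b : 'I_N -> R) (phi v dphi dv : 'I_N -> R -> R) :
  (forall e x, 0 <= x -> phi e x = G (b e) x) ->
  (forall e e', phi e 0 = phi e' 0) -> W_star v ->
  (forall e, is_wderiv (phi e) (dphi e)) -> (forall e, is_wderiv (v e) (dv e)) ->
  \sum_(e < N)
     (\int[mu]_(x in half) (dphi e x * dv e x)
      + omega * \int[mu]_(x in half) (phi e x * v e x)
      - \int[mu]_(x in half) (phi e x * ln ((phi e x) ^+ 2) * v e x))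
  - gamma * (phi e1 0 * v e1 0) = - ((\sum_(e < N) b e + gamma) * (phi e1 0 * v e1 0)).
Proof.
move=> phiE phi0 [[vH1 v0] _] dphiP dvP.
rewrite (eq_bigr (fun e => - (phi e1 0 * v e1 0) * b e)); last first.
  move=> e _; rewrite (gauss_edge_weak (phiE e) (dphiP e) (vH1 e).1 (dvP e)).
  by rewrite -phiE// (phi0 e e1) (v0 e e1); ring.
by rewrite -mulr_sumr; ring.
Qed.

(** Test with [v] on the edge [e] and 0 elsewhere; as [v 0 = 0], this is continuous at the vertex
    and the [gamma] term drops out. *)
Lemma star_weak_edge (phi dphi : 'I_N -> R -> R) (e : 'I_N) :
  weak_stationary e1 gamma omega phi -> (forall e, is_wderiv (phi e) (dphi e)) ->
  forall v dv : R -> R, L2_half v -> is_wderiv v dv ->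
  L1 half (fun x => v x ^+ 2 * ln (v x ^+ 2)) -> v 0 = 0 ->
  \int[mu]_(x in half) (dphi e x * dv x) + omega * \int[mu]_(x in half) (phi e x * v x)
  - \int[mu]_(x in half) (phi e x * ln (phi e x ^+ 2) * v x) = 0.
Proof.
move=> weak dphiP v dv L2v dvP lnv v0.
pose V (i : 'I_N) := if i == e then v else fun=> 0.
pose dV (i : 'I_N) := if i == e then dv else fun=> 0.
have dVP i : is_wderiv (V i) (dV i).
  by rewrite /V /dV; case: (i == e) => //; exact: wderiv_zero.
have V0 i : V i 0 = 0 by rewrite /V; case: (i == e).
have WV : W_star V.
  split; first split.
  - move=> i; split; last by exists (dV i).
    by rewrite /V; case: (i == e) => //; exact: L2_zero.
  - by move=> i j; rewrite !V0.
  move=> i; rewrite /V; case: (i == e) => //.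
  by apply: L1_ext (L1_zero measurable_half) => // x _; rewrite expr0n mul0r.
have := weak V WV dphi dV dphiP dVP; rewrite V0 !mulr0 subr0 (bigD1 e)//= big1.
  by rewrite addr0 /V /dV eqxx.
move=> i ie; rewrite /V /dV (negbTE ie).
have z (p : R -> R) : \int[mu]_(x in half) (p x * 0) = 0.
  rewrite (@eq_Rintegral _ _ _ mu _ (fun=> 0)) ?Rintegral_cst ?mul0r// => t _.
  by rewrite mulr0.
by rewrite !z mulr0 addr0 subr0.
Qed.

Lemma phi_kappa_gauss (k : nat) (i : 'I_N) x : phi_kappa k omega gamma i x =
  G (if (i < k)%N then h_kappa N k gamma else - h_kappa N k gamma) x.
Proof. by rewrite /phi_kappa /gauss; case: ifP => // _; rewrite opprK. Qed.

Lemma phi_kappa0 (k : nat) (i : 'I_N) :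
  phi_kappa k omega gamma i 0 = G (h_kappa N k gamma) 0.
Proof.
by rewrite phi_kappa_gauss; case: ifP => // _; rewrite /gauss !sub0r opprK sqrrN.
Qed.

(** [N - 2 * kappa] in [h_kappa] is a truncated subtraction of naturals; this strict inequality
    makes it a genuine positive difference. *)
Lemma le_half_pred (k : nat) : (k <= (N - 1)./2)%N -> (2 * k < N)%N.
Proof. by move=> kN; lia. Qed.

(** The left-hand side is the sum of the centres when [k] edges carry [+ h] and [N - k] carry [- h],
    so this is the vertex condition. *)
Lemma h_kappa_mul (k : nat) : (k <= (N - 1)./2)%N ->
  h_kappa N k gamma * (2 * k%:R - N%:R) = - gamma.
Proof.
move=> /le_half_pred kN; rewrite /h_kappa natrB ?(ltnW kN)// natrM.
have : N%:R - 2 * k%:R != 0 :> R by rewrite subr_eq0 -natrM eqr_nat; lia.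
by move=> ?; field.
Qed.

Lemma h_kappa_gt0 (k : nat) : (k <= (N - 1)./2)%N -> 0 < h_kappa N k gamma.
Proof. by move=> /le_half_pred kN; rewrite divr_gt0// ltr0n subn_gt0. Qed.

Lemma phi_kappa_stationary (phi : 'I_N -> R -> R) (k : nat) (s : {perm 'I_N}) :
  (k <= (N - 1)./2)%N ->
  (forall i x, 0 <= x -> phi i x = phi_kappa k omega gamma (s i) x) ->
  W_star phi /\ (forall i x, 0 < x -> 0 < phi i x) /\ weak_stationary e1 gamma omega phi.
Proof.
move=> kN phiE.
pose b (i : 'I_N) := if (s i < k)%N then h_kappa N k gamma else - h_kappa N k gamma.
have phiG e x : 0 <= x -> phi e x = G (b e) x.
  by move=> x0; rewrite phiE// phi_kappa_gauss.
have phi0 e e' : phi e 0 = phi e' 0 by rewrite !phiE// !phi_kappa0.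
split; first exact: gauss_star_W phiG phi0.
split=> [i x x0|v Wv dphi dv dphiP dvP]; first by rewrite phiG ?ltW// gauss_gt0.
rewrite (gauss_star_weak phiG phi0 Wv dphiP dvP).
have -> : \sum_(e < N) b e = - gamma.
  (* Summing along the inverse permutation puts the [k] edges with centre [+ h] first. *)
  rewrite (reindex_inj (perm_inj (s := s^-1)%g))/=.
  rewrite (eq_bigr (fun i : 'I_N =>
    if [pred i : 'I_N | (i < k)%N] i then h_kappa N k gamma else - h_kappa N k gamma)).
    by rewrite sum_signs card_ord_lt ?h_kappa_mul//; have := le_half_pred kN; lia.
  by move=> i _; rewrite /b permKV.
by rewrite addNr mul0r oppr0.
Qed.

Lemma stationary_phi_kappa (phi : 'I_N -> R -> R) :
  W_star phi -> (forall i x, 0 < x -> 0 < phi i x) -> weak_stationary e1 gamma omega phi ->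
  exists k : nat, (k <= (N - 1)./2)%N /\ exists s : {perm 'I_N},
    forall i x, 0 <= x -> phi i x = phi_kappa k omega gamma (s i) x.
Proof.
move=> [[phiH1 phi0] philn] phi_gt0 weak.
have [dphi dphiP] := choice (fun e => (phiH1 e).2).
have [b phiG] := choice (fun e => edge_solution (phi_gt0 e) (phiH1 e).1 (dphiP e)
  (philn e) (@star_weak_edge phi dphi e weak dphiP)).
have p0 : 0 < phi e1 0 by rewrite phiG// gauss_gt0.
(* All Gaussians have the same amplitude, so equal vertex values mean equal squared centres. *)
have b2 e : b e ^+ 2 = b e1 ^+ 2.
  have := phi0 e e1; rewrite !phiG// /gauss => /(mulfI (lt0r_neq0 A0))/expR_inj.
  by rewrite !sub0r !sqrrN; lra.
have sumb : \sum_(e < N) b e = - gamma.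
  (* The same centred Gaussian on every edge is an admissible test function that does not vanish at
     the vertex. *)
  pose v (e : 'I_N) := gauss A 0 : R -> R.
  have vE (e : 'I_N) x : 0 <= x -> v e x = G 0 x by [].
  have v0 (e e' : 'I_N) : v e 0 = v e' 0 by [].
  have Wv := @gauss_star_W (fun=> 0) v vE v0.
  have [dv dvP] := choice (fun e => (Wv.1.1 e).2).
  have := weak v Wv dphi dv dphiP dvP.
  rewrite (gauss_star_weak phiG phi0 Wv dphiP dvP) => /eqP.
  rewrite oppr_eq0 mulf_eq0 (gt_eqF (mulr_gt0 p0 (gauss_gt0 0 0 A0))) orbF.
  by rewrite addr_eq0 => /eqP.
pose h := `|b e1|; pose P := [pred e : 'I_N | 0 < b e].
have bE e : b e = if P e then h else - h.
  have : `|b e| = h by rewrite /h -!sqrtr_sqr b2.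
  rewrite /= => <-; case: ltP => be; first by rewrite gtr0_norm.
  by rewrite ler0_norm// opprK.
have hE : h * (N%:R - 2 * #|P|%:R) = gamma.
  have : \sum_(e < N) b e = h * (2 * #|P|%:R - N%:R).
    by rewrite -sum_signs; apply: eq_bigr => e _; exact: bE.
  by rewrite sumb; lra.
(* From [h >= 0] and [h (N - 2 |P|) = gamma > 0], the second factor is positive. *)
have PN : (2 * #|P| < N)%N.
  rewrite -(ltr_nat R) natrM -subr_gt0; have : 0 <= h by exact: normr_ge0.
  by move: hgamma; rewrite -hE; nra.
exists #|P|; split; first by lia.
have [s sP] := perm_initial_segment P; exists s => i x x0.
rewrite phiG// phi_kappa_gauss sP bE.
have -> : h_kappa N #|P| gamma = h; last by [].
rewrite /h_kappa natrB ?(ltnW PN)// natrM -hE mulfK// subr_eq0 -natrM eqr_nat.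
by lia.
Qed.

(** The vertex value is the same on all edges, so it is insensitive to permutations. It determines
    [h^2], hence the positive number [h], and then [kappa] through [h (2 kappa - N) = - gamma]. *)
Lemma phi_kappa_inj (k1 k2 : nat) (i j : 'I_N) :
  (k1 <= (N - 1)./2)%N -> (k2 <= (N - 1)./2)%N ->
  phi_kappa k1 omega gamma i 0 = phi_kappa k2 omega gamma j 0 -> k1 = k2.
Proof.
move=> k1N k2N; rewrite !phi_kappa0 /gauss => /(mulfI (lt0r_neq0 A0))/expR_inj.
have h1 := h_kappa_gt0 k1N; have h2 := h_kappa_gt0 k2N.
rewrite !sub0r !sqrrN => h12.
have hh : h_kappa N k1 gamma = h_kappa N k2 gamma.
  apply/eqP; rewrite -(@eqrXn2 _ 2)// ?ltW//; apply/eqP; lra.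
have := h_kappa_mul k1N; rewrite -(h_kappa_mul k2N) hh => /(mulfI (lt0r_neq0 h2)).
by move=> /addIr/(mulfI _) E; apply/eqP; rewrite -(eqr_nat R) E// pnatr_eq0.
Qed.

End fixed.
End StarGraph.

Unset Implicit Arguments.

Theorem theorem1p2 (R : realType) (N : nat) (hN : (1 < N)%N) (gamma omega : R)
    (hgamma : 0 < gamma) :
  (forall phi : 'I_N -> R -> R,
     (W_star phi /\ (forall i x, 0 < x -> 0 < phi i x) /\
      weak_stationary (Ordinal (ltnW hN)) gamma omega phi)
     <->
     (exists kappa : nat, (kappa <= (N - 1)./2)%N /\
        exists sigma : {perm 'I_N},
          forall i x, 0 <= x -> phi i x = phi_kappa kappa omega gamma (sigma i) x))
  /\
  (forall k1 k2 : nat, (k1 <= (N - 1)./2)%N -> (k2 <= (N - 1)./2)%N ->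
     (exists sigma : {perm 'I_N}, forall i x, 0 <= x ->
        phi_kappa k1 omega gamma (sigma i) x = phi_kappa k2 omega gamma i x) ->
     k1 = k2).
Proof.
split=> [phi|k1 k2 k1N k2N [s sE]].
  split=> [[Wphi [phi_gt0 weak]]|[k [kN [s phiE]]]].
    exact: (@stationary_phi_kappa R N hN).
  exact: (@phi_kappa_stationary R N hN _ _ hgamma _ k s).
exact: (phi_kappa_inj hN hgamma k1N k2N (sE (Ordinal (ltnW hN)) 0 (lexx _))).
Qed.
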